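(* For all $k=1,2,\dots$, the quantities $B_k$ (length of the $k$-th busy period), $C_k$ (length of the $k$-th busy cycle), $I_k$ (length of the $k$-th idle period) and $E_k$ (number of arrivals, or service completions, in the $k$-th busy cycle) are invariant with respect to coherent systems and equal to the corresponding quantities of the actual system.
   Context: Time is discrete, $\tau=0,1,2,\dots$. Consider a single-server queue with a work-conserving discipline (the server is not idle when there is work in the system). In the actual system customer $k\ge1$ arrives at the integer time $A_k$ and departs at the integer time $D_k$, with $0\le A_k\le A_{k+1}<\infty$, $A_k\to\infty$, $D_k<\infty$, and service times at least one. Inter-arrival times and service times are i.i.d. and independent of each other, with means $1/\alpha$ and $1/\beta$, $0<\alpha,\beta<\infty$, and traffic intensity $\rho=\alpha/\beta<1$. The system is empty at time $0$. Let $W_k=D_k-A_k=\sum_{\tau}\mathbf 1\{A_k<\tau\le D_k\}$ be the actual waiting time in the system, and let $A(\tau)=\#\{k:A_k\le\tau\}$ be the number of (actual) arrivals in $(0,\tau]$. Near each integer $\tau$ there are instants $\tau^{--}<\tau^-<\tau<\tau^+$ infinitesimally close to $\tau$. A scheduling rule replaces $A_k,D_k$ by scheduled instants $A'_k,D'_k$, as follows. EAS (early arrival): $A'_k\in(A_k,A_k^+)$, $D'_k\in(D_k^-,D_k)$. LAS-IA (late arrival, immediate access): $A'_k\in(A_k^-,A_k)$, $D'_k\in(D_k-1,(D_k-1)^+)$. LAS-DA (late arrival, delayed access): $A'_k\in(A_k^-,A_k)$, $D'_k\in(D_k,D_k^+)$. LA-AF (late arrivals, arrivals first): $A'_k\in(A_k^{--},A_k^-)$,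 $D'_k\in(D_k^-,D_k)$. LA-DF (late arrivals, departures first): $A'_k\in(A_k^-,A_k)$, $D'_k\in(D_k^{--},D_k^-)$. The observation epoch $u(\tau)$ is one of: random observer (slot edge), $u(\tau)=\tau$; outside observer (slot center), $u(\tau)=\tau-0.5$; or the potential pre-arrival, post-arrival, pre-departure, post-departure epochs, which are respectively $\tau,\tau^+,\tau^-,\tau$ for EAS; $\tau^-,\tau,\tau,\tau^+$ for LAS-IA and for LAS-DA; $\tau^{--},\tau^-,\tau^-,\tau$ for LA-AF; $\tau^-,\tau,\tau^{--},\tau^-$ for LA-DF. A system (a combination of scheduling rule and observation epoch) is called coherent if for all customers $k=1,2,\dots$ the observed waiting time equals the actual one: $$\sum_{\tau=1}^{\infty}\mathbf 1\{A'_k<u(\tau)\le D'_k\}=\sum_{\tau=1}^{\infty}\mathbf 1\{A_k<\tau\le D_k\}.$$ Let $L(u(\tau))=\sum_{k\ge1}\mathbf 1\{A'_k<u(\tau)\le D'_k\}$ be the observed number of customers in the system. For $j=1,2,\dots$ let $$a(u(j))=\mathbf 1\{L(u(j)-1)=0,\ L(u(j))\ge1\},\qquad d(u(j))=\mathbf 1\{L(u(j)-1)\ge1,\ L(u(j))=0\},$$ and let $A_B(0,\tau)=\sum_{j=1}^{\tau}a(u(j))$, $D_B(0,\tau)=\sum_{j=1}^{\tau}d(u(j))$, $U_k=\min\{\tau:A_B(0,\tau)=k\}$, $V_k=\min\{\tau:D_B(0,\tau)=k\}$ (so that $U_k<V_k<U_{k+1}$). Define $$C_k=U_{k+1}-U_k,\quad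 B_k=V_k-U_k,\quad I_k=U_{k+1}-V_k,\quad E_k=A(U_{k+1})-A(U_k).$$ The corresponding actual-system quantities are defined by the same formulas with $A'_k,D'_k,u(\tau)$ replaced by $A_k,D_k,\tau$, so that $L(\tau)=\sum_{k\ge1}\mathbf 1\{A_k<\tau\le D_k\}$; the counting process $A(\tau)$ is the same.
   Formalization: With the common A(τ)=#{k: A_k≤τ}, E_k is not invariant; here E_k counts arrivals with A'_k<u(τ) (actual: A_k<τ) between U_k and U_{k+1}. The E_k claim with the common A(τ) is kept for coherent systems that do not see an arrival in its own slot. *)

(* Defs.v *)
(* Customers are numbered from 0, busy cycles from 1. *)
From HB Require Import structures.
From mathcomp Require Import all_boot all_order all_algebra.
From mathcomp Require Import finmap.
From mathcomp Require Import all_classical all_reals all_analysis.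

Set Implicit Arguments.
Unset Strict Implicit.
Unset Printing Implicit Defensive.

Import Order.TTheory GRing.Theory Num.Theory.
Import numFieldNormedType.Exports.

Local Open Scope classical_set_scope.
Local Open Scope ring_scope.


(* Slot t is the interval (t-1, t].  [serve t] is the customer, if any, whose
   work is carried out in slot t; a customer leaves at the end of the slot in
   which its last unit of work is carried out.  Nothing is said about which
   customer is chosen, so the order of service is arbitrary and preemption is
   allowed. *)
Definition work_conserving (A D S : nat -> nat) : Prop :=
  exists serve : nat -> option nat,
    [/\ forall t k, serve t = Some k -> (A k < t <= D k)%N,
        forall k, (\sum_(1 <= t < (D k).+1) (serve t == Some k))%N = S k,
        forall k, serve (D k) = Some k &
        forall t, (exists k, (A k < t <= D k)%N) -> serve t <> None].

Record sample_path (A D X S : nat -> nat) : Prop := {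
  arrival_step : forall k, A k.+1 = (A k + X k)%N ;
  arrivals_to_infinity : forall t, \forall k \near \oo, (t < A k)%N ;
  service_ge1 : forall k, (1 <= S k)%N ;
  single_server : work_conserving A D S }.

Section Probability.
Context {d : measure_display} {T : measurableType d} {R : realType}.
Variable P : probability T R.

Definition mutually_independent (I : choiceType) (Z : I -> T -> nat) : Prop :=
  forall (J : {fset I}) (B : I -> set nat),
    (forall i, measurable (B i)) ->
    P (\bigcap_(i in [set` J]) (Z i @^-1` B i)) =
    (\prod_(i <- J) P (Z i @^-1` B i))%E.

Definition identically_distributed (I : Type) (Z : I -> T -> nat) : Prop :=
  forall (i j : I) (B : set nat), measurable B ->
    P (Z i @^-1` B) = P (Z j @^-1` B).

(* Joint independence of the family X_0, X_1, ..., S_0, S_1, ... *)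
Definition joint_family (X S : nat -> T -> nat) (i : nat + nat) : T -> nat :=
  match i with inl k => X k | inr k => S k end.

Record stochastic_input (X S : nat -> {RV P >-> nat}) (alpha beta : R) : Prop := {
  joint_independence : mutually_independent (joint_family X S) ;
  interarrival_id : identically_distributed X ;
  service_id : identically_distributed S ;
  alpha_gt0 : 0 < alpha ;
  beta_gt0 : 0 < beta ;
  interarrival_mean : forall k,
    ('E_P[(fun w => (X k w)%:R%R : R)] = (alpha^-1)%R%:E)%E ;
  service_mean : forall k,
    ('E_P[(fun w => (S k w)%:R%R : R)] = (beta^-1)%R%:E)%E ;
  traffic_lt1 : alpha / beta < 1 }.

End Probability.


(* tau-- < tau- < tau < tau+ are modelled as tau - mm < tau - m < tau < tau + p
   for arbitrary real offsets smaller than half a slot: the only fact about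
   "infinitesimally close" that matters is the position of these instants
   relative to each other and to the slot centers. *)
Record edge_offsets (R : realType) := EdgeOffsets {
  off_mm : R ;
  off_m : R ;
  off_p : R ;
  off_m_gt0 : 0 < off_m ;
  off_m_lt_mm : off_m < off_mm ;
  off_mm_lt_half : off_mm < 2^-1 ;
  off_p_gt0 : 0 < off_p ;
  off_p_lt_half : off_p < 2^-1 }.

Inductive scheduling_rule := EAS | LAS_IA | LAS_DA | LA_AF | LA_DF.

Inductive observer :=
  | RandomObserver | OutsideObserver
  | PreArrival | PostArrival | PreDeparture | PostDeparture.

Section Systems.
Context {R : realType}.
Implicit Types (e : edge_offsets R) (a dep u : nat -> R).

Definition minus2 e (x : R) : R := x - off_mm e.
Definition minus1 e (x : R) : R := x - off_m e.
Definition plus1 e (x : R) : R := x + off_p e.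

Definition arrival_window e (r : scheduling_rule) (x : R) : set R :=
  match r with
  | EAS => [set y | x < y < plus1 e x]
  | LAS_IA => [set y | minus1 e x < y < x]
  | LAS_DA => [set y | minus1 e x < y < x]
  | LA_AF => [set y | minus2 e x < y < minus1 e x]
  | LA_DF => [set y | minus1 e x < y < x]
  end.

Definition departure_window e (r : scheduling_rule) (x : R) : set R :=
  match r with
  | EAS => [set y | minus1 e x < y < x]
  | LAS_IA => [set y | x - 1 < y < plus1 e (x - 1)]
  | LAS_DA => [set y | x < y < plus1 e x]
  | LA_AF => [set y | minus1 e x < y < x]
  | LA_DF => [set y | minus2 e x < y < minus1 e x]
  end.

Definition scheduled e (r : scheduling_rule) (A D : nat -> nat) a dep : Prop :=
  forall k, arrival_window e r (A k)%:R (a k) /\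
            departure_window e r (D k)%:R (dep k).

Definition epoch e (r : scheduling_rule) (o : observer) (t : nat) : R :=
  let x : R := t%:R in
  match o, r with
  | RandomObserver, _ => x
  | OutsideObserver, _ => x - 2^-1
  | PreArrival, EAS => x
  | PreArrival, LAS_IA => minus1 e x
  | PreArrival, LAS_DA => minus1 e x
  | PreArrival, LA_AF => minus2 e x
  | PreArrival, LA_DF => minus1 e x
  | PostArrival, EAS => plus1 e x
  | PostArrival, LAS_IA => x
  | PostArrival, LAS_DA => x
  | PostArrival, LA_AF => minus1 e x
  | PostArrival, LA_DF => x
  | PreDeparture, EAS => minus1 e x
  | PreDeparture, LAS_IA => x
  | PreDeparture, LAS_DA => x
  | PreDeparture, LA_AF => minus1 e x
  | PreDeparture, LA_DF => minus2 e x
  | PostDeparture, EAS => x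
  | PostDeparture, LAS_IA => plus1 e x
  | PostDeparture, LAS_DA => plus1 e x
  | PostDeparture, LA_AF => x
  | PostDeparture, LA_DF => minus1 e x
  end.


(* A system is given by its arrival instants a, departure instants dep and
   observation epochs u.  The actual system is the case a = A, dep = D,
   u(t) = t, through the embedding [instants] of nat into R. *)
Definition instants (N : nat -> nat) : nat -> R := fun k => (N k)%:R.
Definition slot_edges : nat -> R := instants id.

Definition present a dep (k : nat) (x : R) : bool := a k < x <= dep k.

Definition waiting_time a dep u (k : nat) : \bar R :=
  (\sum_(1 <= t <oo) (present a dep k (u t))%:R%:E)%E.

Definition coherent (A D : nat -> nat) a dep u : Prop :=
  forall k, waiting_time a dep u k =
            waiting_time (instants A) (instants D) slot_edges k.

Definition number_in_system a dep (x : R) : \bar R :=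
  (\sum_(k <oo) (present a dep k x)%:R%:E)%E.

Definition busy_start a dep u (j : nat) : bool :=
  (number_in_system a dep (u j - 1)%R == 0%E) &&
  (1 <= number_in_system a dep (u j))%E.

Definition busy_end a dep u (j : nat) : bool :=
  (1 <= number_in_system a dep (u j - 1)%R)%E &&
  (number_in_system a dep (u j) == 0%E).

Definition busy_starts a dep u (t : nat) : nat :=
  (\sum_(1 <= j < t.+1) busy_start a dep u j)%N.

Definition busy_ends a dep u (t : nat) : nat :=
  (\sum_(1 <= j < t.+1) busy_end a dep u j)%N.

(* The minimum of a set of naturals, None when the set is empty.  On a sample
   path with only finitely many busy cycles the later U_k, V_k do not exist;
   None keeps the quantities derived from them undefined. *)
Definition min_slot (p : pred nat) : option nat :=
  match pselect (exists t, p t) with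
  | left ex => Some (ex_minn ex)
  | right _ => None
  end.

Definition U a dep u (k : nat) : option nat :=
  min_slot (fun t => busy_starts a dep u t == k).

Definition V a dep u (k : nat) : option nat :=
  min_slot (fun t => busy_ends a dep u t == k).

Definition slot_diff (x y : option nat) : option int :=
  match x, y with
  | Some m, Some n => Some (m%:Z - n%:Z)
  | _, _ => None
  end.

Definition busy_cycle a dep u (k : nat) : option int :=
  slot_diff (U a dep u k.+1) (U a dep u k).

Definition busy_period a dep u (k : nat) : option int :=
  slot_diff (V a dep u k) (U a dep u k).

Definition idle_period a dep u (k : nat) : option int :=
  slot_diff (U a dep u k.+1) (V a dep u k).

(* N(U_{k+1}) - N(U_k), for an arrival counting process N. *)
Definition cycle_increment (N : nat -> \bar R) a dep u (k : nat) :
    option (\bar R) :=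
  match U a dep u k.+1, U a dep u k with
  | Some m, Some n => Some (N m - N n)%E
  | _, _ => None
  end.

Definition slot_arrivals (A : nat -> nat) (t : nat) : \bar R :=
  (\sum_(k <oo) (A k <= t)%N%:R%:E)%E.

Definition arrivals_seen a u (t : nat) : \bar R :=
  (\sum_(k <oo) (a k < u t)%R%:R%:E)%E.

(* The number of arrivals in the k-th cycle of a system is counted on that
   system's own clock, with the convention a < u(t) already used in [present].
   Counting with [slot_arrivals A] in all systems would not be invariant: if
   an arrival is seen in its own slot (e.g. EAS, post-arrival epoch) then U_k
   is one slot earlier than in the actual system, and for A = 1, 2, 10, ... with
   unit services the first cycle would get 3 - 1 = 2 arrivals there, but
   3 - 2 = 1 in the actual system. *)
Definition cycle_arrivals a dep u (k : nat) : option (\bar R) :=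
  cycle_increment (arrivals_seen a u) a dep u k.

End Systems.

(* Main.v *)
Require Import Defs.
From HB Require Import structures.
From mathcomp Require Import all_boot all_order all_algebra.
From mathcomp Require Import all_classical all_reals all_analysis.
From mathcomp Require Import lra.
From mathcomp Require Import zify.

(** Every scheduled instant lies strictly between two consecutive named
    instants around an integer, and every observation epoch is a named instant
    or a slot center.  Hence an observer cannot tell where inside its window a
    customer was scheduled: what is seen is the actual system, advanced
    by whole slots, separately for arrivals ([arrival_seen]) and for
    departures ([departure_unseen]).  With arrival shift [sa] and departure
    shift [sd], customer [k] is seen in slot [t] exactly when
    [A k < sa + t] and [sd + t <= D k].

    Coherence makes the two shifts agree.  Only the slots [t >= 1] are counted,
    so the observed waiting time is [(D k - sd) - (A k - sa)] in truncated
    arithmetic, while the actual one is the positive number [D k - A k];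
    equality says [sd + (A k - sa) = A k].  A customer arriving after slot [sa]
    gives [sa = sd], and then every customer must satisfy [sa <= A k]
    ([coherent_shift]).

    So a coherent observer sees at time [t] the actual system at time [s + t],
    for a single constant [s], and the actual system is empty up to slot [s],
    where the observer's clock starts.  No busy period starts or ends before,
    hence the k-th start and the k-th end of a busy period are
    observed exactly [s] slots early ([U_shift], [V_shift]).  The shift cancels
    in all differences, and arrivals counted on the observer's own clock are
    shifted in the same way ([cycle_increment_shift]).  Arrivals counted on the
    actual clock are compared when no arrival is seen in its own slot, which
    means [s = 0]. *)

Set Implicit Arguments.
Unset Strict Implicit.
Unset Printing Implicit Defensive.

Import Order.TTheory GRing.Theory Num.Theory.
Import numFieldNormedType.Exports.

Local Open Scope classical_set_scope.
Local Open Scope ring_scope.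

(** * Observed instants as shifts by whole slots *)

(** The values are read off from the order of the windows and the epochs:
    1 when the epoch of slot [t] comes after the arrival window around [t],
    so that a customer arriving at [t] is already seen in slot [t], else 0. *)
Definition arrival_shift (r : scheduling_rule) (o : observer) : nat :=
  match r, o with
  | _, OutsideObserver | _, PreArrival => 0
  | EAS, PostArrival => 1
  | EAS, _ => 0
  | LA_DF, PreDeparture | LA_DF, PostDeparture => 0
  | _, _ => 1
  end.

(** The number of slots up to and including slot [D k] in which the departure
    is already seen.  It is 2 when departures are scheduled just after [D k - 1]
    and the epoch of slot [D k - 1] comes after that window. *)
Definition departure_shift (r : scheduling_rule) (o : observer) : nat :=
  match r, o with
  | LAS_IA, PostDeparture => 2
  | LAS_IA, _ => 1
  | _, OutsideObserver | _, PreDeparture => 0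
  | LAS_DA, PostDeparture => 1
  | LAS_DA, _ => 0
  | LA_AF, PreArrival | LA_AF, PostArrival => 0
  | _, _ => 1
  end.

Section Epochs.
Context {R : realType}.
Implicit Types (e : edge_offsets R) (r : scheduling_rule) (o : observer).

(** The two inequalities place the epoch [x] of slot [t] after the window
    [lo, hi] moved from [n] to [t + s - 1] and before the window moved to
    [t + s].  They compare the named instants only, so the answer does not
    depend on [y]. *)
Lemma window_before_epoch (n s t : nat) (lo hi x y : R) :
  lo < y < hi -> x - t%:R <= lo - n%:R + s%:R ->
  hi - n%:R - 1 + s%:R <= x - t%:R -> (y < x) = (n < s + t)%N.
Proof.
move=> /andP[loy yhi] xlo hix; case: (ltnP n) => [nst|stn].
- have : n%:R + 1 <= s%:R + t%:R :> R by rewrite natr1 -natrD ler_nat.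
  by move=> ?; lra.
- have ? : s%:R + t%:R <= n%:R :> R by rewrite -natrD ler_nat.
  by apply/negbTE; rewrite -leNgt; lra.
Qed.

Lemma arrival_seen e r o (n t : nat) (y : R) :
  arrival_window e r n%:R y ->
  (y < epoch e r o t) = (n < arrival_shift r o + t)%N.
Proof.
move: (off_m_gt0 e) (off_m_lt_mm e) (off_mm_lt_half e) (off_p_gt0 e).
move: (off_p_lt_half e) => ? ? ? ? ?.
by case: r; case: o => /window_before_epoch; apply => /=;
  rewrite /plus1 /minus1 /minus2; lra.
Qed.

(** Being still present is the negation of the departure window lying before
    the epoch, so the comparison made for arrivals applies again. *)
Lemma departure_unseen e r o (n t : nat) (y : R) :
  departure_window e r n%:R y ->
  (epoch e r o t <= y) = (departure_shift r o + t <= n)%N.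
Proof.
rewrite leNgt leqNgt.
move: (off_m_gt0 e) (off_m_lt_mm e) (off_mm_lt_half e) (off_p_gt0 e).
move: (off_p_lt_half e) => ? ? ? ? ?.
move=> yw; congr (~~ _); move: yw.
by case: r; case: o => /window_before_epoch; apply => /=;
  rewrite /plus1 /minus1 /minus2; lra.
Qed.

Lemma epoch_pred e r o t : epoch e r o t.+1 - 1 = epoch e r o t.
Proof.
by case: o; case: r => /=;
  rewrite /plus1 /minus1 /minus2 -addn1 natrD; lra.
Qed.

Lemma slot_edges_pred t : @slot_edges R t.+1 - 1 = slot_edges t.
Proof. by rewrite /slot_edges /instants /= -addn1 natrD addrK. Qed.

Lemma present_slot_edges (A D : nat -> nat) k t :
  present (@instants R A) (instants D) k (slot_edges t) = (A k < t <= D k)%N.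
Proof. by rewrite /present /slot_edges /instants ltr_nat ler_nat. Qed.

End Epochs.

(** * Coherence forces equal shifts *)

Section WaitingTime.
Context {R : realType}.

Lemma waiting_time_interval (a dep u : nat -> R) k m n :
  (forall t, (0 < t)%N -> present a dep k (u t) = (m < t <= n)%N) ->
  waiting_time a dep u k = (n - m)%N%:R%:E.
Proof.
move=> Hp; have partial N : (\sum_(1 <= t < N.+1)
    (present a dep k (u t))%:R%:E = (minn N n - m)%N%:R%:E :> \bar R)%E.
  elim: N => [|N IHN]; first by rewrite big_geq // min0n.
  rewrite big_nat_recr //= IHN Hp // -EFinD -natrD.
  by congr (_%:R%:E); case: (boolP (m < N.+1 <= n)%N); lia.
apply: cvg_lim => //; apply: cvg_near_cst; exists n.+1 => // N /=.
by case: N => // N nN; rewrite partial (minn_idPr _).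
Qed.

(** A mismatch of the shifts may go unnoticed on customers that arrive before
    slot [sa], because the slots before the first one are not counted; this is
    why arrivals tending to infinity are used. *)
Lemma coherent_shift (A D : nat -> nat) (a dep u : nat -> R) sa sd :
  (forall k, (A k < D k)%N) -> (forall t, \forall k \near \oo, (t < A k)%N) ->
  (forall k t, (a k < u t) = (A k < sa + t)%N) ->
  (forall k t, (u t <= dep k) = (sd + t <= D k)%N) ->
  coherent A D a dep u -> sa = sd /\ forall k, (sa <= A k)%N.
Proof.
move=> AD Aoo Ha Hd Hcoh.
have eqk k : (sd + (A k - sa) = A k)%N.
  have := Hcoh k.
  rewrite (@waiting_time_interval _ _ _ _ (A k - sa) (D k - sd)); last first.
    by move=> t t0; rewrite /present Ha Hd; lia.
  rewrite (@waiting_time_interval _ _ _ _ (A k) (D k)); last first.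
    by move=> t t0; rewrite present_slot_edges.
  move=> -[] /eqP; rewrite eqr_nat => /eqP.
  by have := AD k; lia.
(* For a customer N arriving after slot sa the subtraction is exact. *)
have [N _ AN] := Aoo sa; have := AN N (leqnn N); have := eqk N => /= ? ?.
by have sas : sa = sd by [lia]; split=> // k; have := eqk k; lia.
Qed.

End WaitingTime.

(** * Counting events on a shifted clock *)

Section ShiftedSlots.

(** Both sides are [None] together, since all the solutions of [q] are
    translates of solutions of [p]. *)
Lemma min_slot_shift (p q : pred nat) s :
  (forall t, p t = q (s + t)%N) -> (forall t, (t < s)%N -> ~~ q t) ->
  min_slot q = omap (addn s) (min_slot p).
Proof.
move=> pq q0; rewrite /min_slot.
case: (pselect (exists t, p t)) => [exp|nexp];
  case: (pselect (exists t, q t)) => [exq|nexq] //=.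
- case: ex_minnP => m qm mmin; case: ex_minnP => n pn nmin.
  have sm : (s <= m)%N by rewrite leqNgt; apply/negP => /q0; rewrite qm.
  congr Some; apply/eqP; rewrite eqn_leq mmin -?pq //=.
  by rewrite -leq_subRL// nmin// pq subnKC.
- by case: nexq; case: exp => t pt; exists (s + t)%N; rewrite -pq.
- case: nexp; case: exq => t qt; exists (t - s)%N; rewrite pq subnKC //.
  by rewrite leqNgt; apply/negP => /q0; rewrite qt.
Qed.

Lemma event_count_shift (f g : nat -> bool) s t :
  (forall j, (0 < j)%N -> f j = g (s + j)%N) ->
  (forall j, (0 < j <= s)%N -> g j = false) ->
  (\sum_(1 <= j < t.+1) f j = \sum_(1 <= j < (s + t).+1) g j)%N.
Proof.
move=> fg g0; elim: t => [|t IHt].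
  rewrite addn0 big_geq // big_nat big1 // => j /andP[j0 js].
  by rewrite g0 // j0 -ltnS.
by rewrite big_nat_recr // IHt fg // addnS [RHS]big_nat_recr.
Qed.

Lemma slot_diff_shift s x y :
  slot_diff (omap (addn s) x) (omap (addn s) y) = slot_diff x y.
Proof. by case: x y => [x|] [y|] //=; congr Some; lia. Qed.

End ShiftedSlots.

(** * Busy periods of a system seen with a constant shift *)

Section ShiftedSystems.
Context {R : realType}.
(** Emptiness of [(b, q, v)] up to slot [s] is what prevents it from having
    busy periods that [(a, dep, u)] misses. *)
Variables (a dep u b q v : nat -> R) (s : nat).
Hypothesis u_pred : forall t, u t.+1 - 1 = u t.
Hypothesis v_pred : forall t, v t.+1 - 1 = v t.
Hypothesis present_shift :
  forall k t, present a dep k (u t) = present b q k (v (s + t)%N).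
Hypothesis initially_empty :
  forall k t, (t <= s)%N -> present b q k (v t) = false.

Lemma number_in_system_shift t :
  number_in_system a dep (u t) = number_in_system b q (v (s + t)%N).
Proof. by apply: eq_eseriesr => k _; rewrite present_shift. Qed.

Lemma number_in_system_initially t :
  (t <= s)%N -> number_in_system b q (v t) = 0%E.
Proof.
by move=> ts; apply: eseries0 => k _ _; rewrite initially_empty.
Qed.

(** The slot [0] is excluded because a busy start compares with the epoch one
    unit of time earlier, which is the epoch of a slot only from slot 1 on. *)
Lemma busy_start_shift j :
  (0 < j)%N -> busy_start a dep u j = busy_start b q v (s + j).
Proof.
case: j => // j _; rewrite /busy_start addnS u_pred v_pred.
by rewrite -addnS !number_in_system_shift.
Qed.

Lemma busy_end_shift j :
  (0 < j)%N -> busy_end a dep u j = busy_end b q v (s + j).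
Proof.
case: j => // j _; rewrite /busy_end addnS u_pred v_pred.
by rewrite -addnS !number_in_system_shift.
Qed.

Lemma no_busy_start_initially j : (0 < j <= s)%N -> busy_start b q v j = false.
Proof.
move=> /andP[_ js]; rewrite /busy_start (number_in_system_initially js).
by rewrite lee_fin ler10 andbF.
Qed.

Lemma no_busy_end_initially j : (0 < j <= s)%N -> busy_end b q v j = false.
Proof.
case: j => // j /andP[_ js].
rewrite /busy_end v_pred (number_in_system_initially (ltnW js)).
by rewrite lee_fin ler10.
Qed.

(** The index 0 is excluded because the minimum is then attained at slot 0 in
    both systems, with no shift. *)
Lemma U_shift k : (0 < k)%N -> U b q v k = omap (addn s) (U a dep u k).
Proof.
move=> k0; apply: min_slot_shift => [t|t ts].
  congr (_ == k); apply: event_count_shift.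
    exact: busy_start_shift.
  exact: no_busy_start_initially.
rewrite /busy_starts big_nat big1 ?(ltn_eqF k0) // => j /andP[j0 jt].
by rewrite no_busy_start_initially // j0 (leq_trans _ (ltnW ts)).
Qed.

Lemma V_shift k : (0 < k)%N -> V b q v k = omap (addn s) (V a dep u k).
Proof.
move=> k0; apply: min_slot_shift => [t|t ts].
  congr (_ == k); apply: event_count_shift.
    exact: busy_end_shift.
  exact: no_busy_end_initially.
rewrite /busy_ends big_nat big1 ?(ltn_eqF k0) // => j /andP[j0 jt].
by rewrite no_busy_end_initially // j0 (leq_trans _ (ltnW ts)).
Qed.

Lemma cycle_increment_shift (N M : nat -> \bar R) k : (0 < k)%N ->
  (forall t, N t = M (s + t)%N) ->
  cycle_increment N a dep u k = cycle_increment M b q v k.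
Proof.
move=> k0 NM; rewrite /cycle_increment !U_shift //.
by case: (U a dep u k.+1) => [m|]; case: (U a dep u k) => [n|] //=; rewrite !NM.
Qed.

End ShiftedSystems.

(** The customer in service in its last slot is present in that slot. *)
Lemma arrival_before_departure (A D X S : nat -> nat) :
  sample_path A D X S -> forall k, (A k < D k)%N.
Proof. by case=> _ _ _ [serve [+ _ last _]] k => /(_ _ _ (last k)) /andP[]. Qed.

Theorem lemma6p4 (R : realType) (disp : measure_display)
    (T : measurableType disp) (P : probability T R)
    (A D X S : nat -> {RV P >-> nat}) (alpha beta : R)
    (e : edge_offsets R) (r : scheduling_rule) (o : observer)
    (A' D' : nat -> T -> R) (w : T)
    (Hinput : stochastic_input X S alpha beta)
    (Hpath : sample_path (A ^~ w) (D ^~ w) (X ^~ w) (S ^~ w))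
    (Hsched : scheduled e r (A ^~ w) (D ^~ w) (A' ^~ w) (D' ^~ w))
    (Hcoh : coherent (A ^~ w) (D ^~ w) (A' ^~ w) (D' ^~ w) (epoch e r o)) :
  forall k : nat, (1 <= k)%N ->
    [/\ busy_period (A' ^~ w) (D' ^~ w) (epoch e r o) k =
          busy_period (@instants R (A ^~ w)) (instants (D ^~ w)) slot_edges k,
        busy_cycle (A' ^~ w) (D' ^~ w) (epoch e r o) k =
          busy_cycle (@instants R (A ^~ w)) (instants (D ^~ w)) slot_edges k,
        idle_period (A' ^~ w) (D' ^~ w) (epoch e r o) k =
          idle_period (@instants R (A ^~ w)) (instants (D ^~ w)) slot_edges k,
        cycle_arrivals (A' ^~ w) (D' ^~ w) (epoch e r o) k =
          cycle_arrivals (@instants R (A ^~ w)) (instants (D ^~ w)) slot_edges k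
      & (forall n, epoch e r o (A n w) <= A' n w) ->
        cycle_increment (slot_arrivals (A ^~ w))
            (A' ^~ w) (D' ^~ w) (epoch e r o) k =
          cycle_increment (slot_arrivals (A ^~ w))
            (@instants R (A ^~ w)) (instants (D ^~ w)) slot_edges k].
Proof.
move=> k k0; set v := slot_edges.
have seen n t : (A' n w < epoch e r o t) = (A n w < arrival_shift r o + t)%N.
  exact: arrival_seen (Hsched n).1.
have unseen n t :
    (epoch e r o t <= D' n w) = (departure_shift r o + t <= D n w)%N.
  exact: departure_unseen (Hsched n).2.
have [] := coherent_shift (arrival_before_departure Hpath)
  (arrivals_to_infinity Hpath) seen unseen Hcoh.
move: unseen => /[swap] <- unseen; set s := arrival_shift r o in seen unseen *.
move=> sA.
have presentE n t : present (A' ^~ w) (D' ^~ w) n (epoch e r o t) =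
    present (@instants R (A ^~ w)) (instants (D ^~ w)) n (v (s + t)%N).
  by rewrite present_slot_edges /present seen unseen.
have empty n t : (t <= s)%N ->
    present (@instants R (A ^~ w)) (instants (D ^~ w)) n (v t) = false.
  by move=> ts; rewrite present_slot_edges ltnNge (leq_trans ts (sA n)).
have u_pred := epoch_pred e r o.
have UE j := U_shift u_pred slot_edges_pred presentE empty (k := j).
have VE j := V_shift u_pred slot_edges_pred presentE empty (k := j).
have incE := cycle_increment_shift u_pred slot_edges_pred presentE empty k0.
split.
- by rewrite /busy_period UE // VE // slot_diff_shift.
- by rewrite /busy_cycle !UE // slot_diff_shift.
- by rewrite /idle_period UE // VE // slot_diff_shift.
- apply: incE => t; apply: eq_eseriesr => n _.
  by rewrite seen /v /slot_edges /instants ltr_nat.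
- (* An arrival that is not seen in its own slot leaves only the shift 0. *)
  move=> late; apply: incE => t.
  have := late 0%N; rewrite leNgt seen -leqNgt -[leqRHS]add0n leq_add2r leqn0.
  by move=> /eqP ->.
Qed.
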